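(* Let $X$ be a non-empty set and let $\mathcal{F}$ be a $C^{\ast}$-subalgebra of $\ell^{\infty}(X)$ containing the constant functions. If $C$ is a non-empty, closed subset of $\delta X$, then there exists a unique $\mathcal{F}$-filter $\varphi$ on $X$ such that $\widehat{\varphi}=C$, where $\widehat{\varphi}=\{p\in\delta X:\varphi\subseteq p\}$.
   Context: $\ell^{\infty}(X)$ is the $C^{\ast}$-algebra of all bounded complex-valued functions on $X$ (pointwise operations, supremum norm, involution given by complex conjugation). A filter on $X$ is a non-empty family of subsets of $X$ closed under finite intersections and under supersets and not containing $\emptyset$. An $\mathcal{F}$-family on $X$ is a non-empty set $\mathcal{A}$ of non-empty subsets of $X$ such that for every $A\in\mathcal{A}$ with $A\neq X$ there exist $B\in\mathcal{A}$ and $f\in\mathcal{F}$ with $f(B)=\{0\}$ and $f(X\setminus A)=\{1\}$. An $\mathcal{F}$-filter is a filter on $X$ which is also an $\mathcal{F}$-family; an $\mathcal{F}$-ultrafilter is an $\mathcal{F}$-filter not properly contained in any other $\mathcal{F}$-filter on $X$. $\delta X$ is the set of all $\mathcal{F}$-ultrafilters on $X$; for $A\subseteq X$ put $\widehat{A}=\{p\in\delta X: A\in p\}$, and give $\delta X$ the topology having $\{\widehat{A}:A\subseteq X\}$ as a base. *)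

(* Defs.v *)
From HB Require Import structures.
From mathcomp Require Import all_boot all_order all_algebra.
From mathcomp Require Import all_classical all_reals all_analysis.
From mathcomp Require Import complex.

Set Implicit Arguments.
Unset Strict Implicit.
Unset Printing Implicit Defensive.

Import Order.TTheory GRing.Theory Num.Theory.
Local Open Scope classical_set_scope.
Local Open Scope ring_scope.
Local Open Scope complex_scope.

Section LInfinity.
Context {R : realType} {X : Type}.
Implicit Types (f g : X -> R[i]) (F : set (X -> R[i])).

(* [Normc.normc] is the modulus with values in [R]; the generic [`|z|] of a
   complex number lives in [R[i]], where [sup] is not available. *)
Definition linfty : set (X -> R[i]) :=
  [set f | has_ubound (range (fun x => Normc.normc (f x)))].

(* The supremum norm only when [X] is inhabited and [f \in linfty]:
   [sup] returns 0 on empty or unbounded sets. *)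
Definition supnorm f : R := sup (range (fun x => Normc.normc (f x))).

Record cstar_subalgebra F : Prop := CstarSubalgebra {
  cstar_linfty : F `<=` linfty;
  cstar0 : F (cst 0);
  cstarD : forall f g, F f -> F g -> F (f \+ g);
  cstarZ : forall (c : R[i]) f, F f -> F (fun x => c * f x);
  cstarM : forall f g, F f -> F g -> F (f \* g);
  cstarC : forall f, F f -> F (fun x => (f x)^*);
  cstar_closed : forall g, linfty g ->
    (forall e : R, 0 < e -> exists2 f, F f & supnorm (f \- g) < e) -> F g }.

End LInfinity.

Section FFilters.
Context {R : realType} {X : Type}.
Variable F : set (X -> R[i]).
Implicit Types (p q phi : set_system X) (A B : set X).

Definition is_Ffamily (a : set_system X) : Prop :=
  [/\ a !=set0,
      forall A, a A -> A !=set0 &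
      forall A, a A -> A <> setT ->
        exists B (f : X -> R[i]),
          [/\ a B, F f, f @` B = [set 0] & f @` (~` A) = [set 1]]].

(* [ProperFilter] asks for [setT] in the filter; for a family closed under
   supersets this is the same as being non-empty. *)
Definition is_Ffilter phi : Prop := ProperFilter phi /\ is_Ffamily phi.

Definition is_Fultrafilter p : Prop :=
  is_Ffilter p /\ forall q, is_Ffilter q -> p `<=` q -> q = p.

Definition delta : Type := {p : set_system X | is_Fultrafilter p}.

Definition hat A : set delta := [set p | sval p A].

Definition hat_filter phi : set delta := [set p | phi `<=` sval p].

HB.instance Definition _ := gen_eqMixin delta.
HB.instance Definition _ := gen_choiceMixin delta.

Let hat_cover : \bigcup_(A in [set: set X]) hat A = setT.
Proof.
apply/seteqP; split=> // p _; exists setT => //.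
by case: p => p /= [[[_ pF] _] _]; exact: filterT.
Qed.

Let hat_join A B (p : delta) : setT A -> setT B -> hat A p -> hat B p ->
  exists D, [/\ setT D, hat D p & hat D `<=` hat A `&` hat B].
Proof.
move=> _ _ pA pB; exists (A `&` B); split=> //.
  move: pA pB; rewrite /hat /=.
  by case: p => p /= [[[_ pF] _] _]; exact: filterI.
move=> [q /= [[[_ qF] _] qmax]]; rewrite /hat /= => qAB.
by split; apply: filterS qAB => x [].
Qed.

HB.instance Definition _ := isBaseTopological.Build delta hat_cover hat_join.

End FFilters.

Arguments hat {R X} F A _.
Arguments hat_filter {R X} F phi _.

(* Main.v *)
Require Import Defs.
From mathcomp Require Import all_boot all_order all_algebra.
From mathcomp Require Import all_classical all_reals all_analysis.
From mathcomp Require Import complex.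
From mathcomp Require Import ring lra.

(** Write B << A ([separated B A]) when a real-valued function of F vanishes on
    B and equals 1 off A.  An F-filter is then a proper filter phi in which
    every A admits some B in phi with B << A, and the whole argument rests on
    four properties of <<: it is monotone, stable under binary intersections,
    reversed by complementation (replace u by 1 - u), and interpolative, that
    is, B << A implies B << E << A for some E ([separated_interpolate]).
    Interpolation is the only place where the completeness of F matters: it
    cuts u at the level 1/2 with the functions min(2u, 1) and max(2u - 1, 0),
    which lie in F because F is stable under absolute values
    ([in_real_norm]), square roots being uniform limits of polynomials.

    By interpolation every proper filter phi contains a largest F-filter, its
    core {A | B << A for some B in phi} ([core_Ffilter]).  Given an F-filter
    phi and A not in phi, the core of the filter generated by phi and the
    complement of A is an F-filter that contains phi and the complements of
    all B << A ([Ffilter_adjoin]).  This has two consequences.  An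
    F-ultrafilter omitting A contains the complement of every B << A
    ([Fultrafilter_dichotomy]); and, extending by Zorn's lemma, an F-filter is
    the intersection of the F-ultrafilters above it ([Ffilter_inter_hat]), so
    that it is determined by its hat, which gives uniqueness.

    For existence, take the core of the intersection of all members of C
    ([hat_filter_core_bigcap]).  If q lies outside C, some A in q belongs to
    no member of C.  Pick B' << B << A with B' and B in q.  By the dichotomy
    the complement of B lies in every member of C, so the complement of B'
    lies in the core; since B' is in q, the core is not included in q. *)

Import Order.TTheory GRing.Theory Num.Theory.
Local Open Scope classical_set_scope.
Local Open Scope ring_scope.
Local Open Scope complex_scope.

(** * Square roots as uniform limits of polynomials *)

Section SqrtIteration.
Set Implicit Arguments.
Unset Strict Implicit.
Context {R : realType}.
Implicit Types w r : R.

(** The n-th iterate is a polynomial in [w] without square root, so it can be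
    formed inside any algebra; on [0, 1] it increases to the square root of
    [w], uniformly in [w]. *)
Fixpoint sqrt_iter w (n : nat) : R :=
  if n is m.+1 then sqrt_iter w m + 2^-1 * (w - sqrt_iter w m ^+ 2) else 0.

(** With y the n-th iterate, one step multiplies the error r - y by
    1 - (r + y) / 2, hence by at most 1 - r / 2.  The second bound is the form
    of the resulting decay that is stable under the induction, because
    (1 - r / 2) (2 + (n + 1) r) <= 2 + n r. *)
Lemma sqrt_iter_bounds r n : 0 <= r <= 1 ->
  0 <= sqrt_iter (r ^+ 2) n <= r /\
  (r - sqrt_iter (r ^+ 2) n) * (2 + n%:R * r) <= 2 * r.
Proof.
move=> /andP[r0 r1]; elim: n => [|n [/andP[]]] /=.
  by rewrite lexx r0; split=> //; lra.
set y := sqrt_iter _ n; move=> y0 yr e_le.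
have n0 : 0 <= n%:R * r by rewrite mulr_ge0.
have step : r - (y + 2^-1 * (r ^+ 2 - y ^+ 2)) = (r - y) * (1 - (r + y) / 2).
  by field.
split; first by apply/andP; split; nra.
rewrite step -[n.+1]addn1 natrD.
apply: le_trans e_le; rewrite -mulrA ler_wpM2l ?subr_ge0//.
nra.
Qed.

Lemma sqrt_iter_error r n : 0 <= r <= 1 ->
  `|r - sqrt_iter (r ^+ 2) n| * n%:R <= 2.
Proof.
move=> r01; have [/andP[y0 yr] e_le] := sqrt_iter_bounds n r01.
rewrite ger0_norm ?subr_ge0//; set y := sqrt_iter _ n in y0 yr e_le *.
have [r0|r_neq0] := eqVneq r 0.
  have -> : r - y = 0 by lra.
  by rewrite mul0r.
have r_gt0 : 0 < r by rewrite lt_neqAle eq_sym r_neq0; case/andP: r01.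
rewrite -(ler_pM2r r_gt0) -mulrA.
apply: le_trans e_le; rewrite ler_wpM2l ?subr_ge0//; lra.
Qed.

End SqrtIteration.

(** * The real functions of the algebra *)

Section FFilterTheory.
Set Implicit Arguments.
Unset Strict Implicit.
Context {R : realType} {X : Type} {F : set (X -> R[i])}.
Context (X_inh : inhabited X) (F_alg : cstar_subalgebra F).
Context (F_cst : forall c : R[i], F (cst c)).
Implicit Types u v : X -> R.

Definition in_real u : Prop := F (fun x => (u x)%:C).

Lemma in_real_cst (c : R) : in_real (fun=> c).
Proof. exact: F_cst. Qed.

Lemma in_realD u v : in_real u -> in_real v -> in_real (fun x => u x + v x).
Proof.
move=> Fu Fv; rewrite /in_real; have := cstarD F_alg Fu Fv.
by congr F; apply/funext => x /=; rewrite raddfD.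
Qed.

Lemma in_realM u v : in_real u -> in_real v -> in_real (fun x => u x * v x).
Proof.
move=> Fu Fv; rewrite /in_real; have := cstarM F_alg Fu Fv.
by congr F; apply/funext => x /=; rewrite rmorphM.
Qed.

Lemma in_realB u v : in_real u -> in_real v -> in_real (fun x => u x - v x).
Proof.
move=> Fu Fv.
have := in_realD Fu (in_realM (in_real_cst (-1)) Fv).
by congr in_real; apply/funext => x; rewrite mulN1r.
Qed.

Lemma normc_real (a : R) : Normc.normc a%:C = `|a|.
Proof. by rewrite /= expr0n addr0 sqrtr_sqr. Qed.

Lemma in_real_bounded u :
  in_real u -> exists2 M : R, 0 < M & forall x, `|u x| <= M.
Proof.
move=> /(cstar_linfty F_alg)[M ubM].
have uM x : `|u x| <= M by rewrite -normc_real; apply: ubM; exists x.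
exists (`|M| + 1) => [|x]; first exact: ltr_wpDl.
by have := ler_norm M; have := uM x; lra.
Qed.

Lemma in_real_closed v :
  (forall e : R, 0 < e -> exists2 u, in_real u & forall x, `|v x - u x| <= e) ->
  in_real v.
Proof.
move=> approx; apply: (cstar_closed F_alg).
  have [u Fu vu] := approx 1 ltr01.
  have [M M0 uM] := in_real_bounded Fu.
  exists (M + 1) => _ [x _ <-]; rewrite normc_real.
  have := ler_normD (v x - u x) (u x); rewrite subrK.
  by have := uM x; have := vu x; lra.
move=> e e0; have [|u Fu vu] := approx (e / 2); first by rewrite divr_gt0.
exists (fun x => (u x)%:C) => //.
apply: (@le_lt_trans _ _ (e / 2)); last by lra.
apply: ge_sup.
  by case: X_inh => x; eexists; exists x.
by move=> _ [x _ <-]; have := vu x; rewrite distrC -normc_real raddfB.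
Qed.

(** With M a bound for u, the function |u| is M times the square root of
    (u / M)^2, whose values lie in [0, 1]. *)
Lemma in_real_norm u : in_real u -> in_real (fun x => `|u x|).
Proof.
move=> Fu; have [M M0 uM] := in_real_bounded Fu.
have M_neq0 : M != 0 by rewrite gt_eqF.
pose w x := (`|u x| / M) ^+ 2.
have Fw : in_real w.
  have := in_realM (in_real_cst (M ^- 2)) (in_realM Fu Fu).
  congr in_real; apply/funext => x; rewrite /w exprMn real_normK ?num_real//.
  by rewrite exprVn mulrC expr2.
have Fit n : in_real (fun x => sqrt_iter (w x) n).
  elim: n => [|n IHn] /=; first exact: in_real_cst.
  apply: in_realD => //; apply: in_realM; first exact: in_real_cst.
  by apply: in_realB => //; exact: in_realM.
apply: in_real_closed => e e0.
(* The error after n steps is at most 2 M / n. *)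
pose n := (Num.trunc (2 * M / e)).+1.
exists (fun x => M * sqrt_iter (w x) n) => [|x].
  by apply: in_realM => //; exact: in_real_cst.
have r01 : 0 <= `|u x| / M <= 1.
  by rewrite divr_ge0 ?(ltW M0)//= ler_pdivrMr// mul1r.
have err := sqrt_iter_error n r01.
have n_gt : 2 * M / e < n%:R by exact: truncnS_gt.
have n_gt0 : 0 < n%:R :> R by [].
have -> : `|u x| - M * sqrt_iter (w x) n = M * (`|u x| / M - sqrt_iter (w x) n).
  by field.
rewrite normrM (gtr0_norm M0) -(ler_pM2r n_gt0) -mulrA.
apply: (@le_trans _ _ (M * 2)); first by rewrite ler_pM2l.
by move: n_gt; rewrite ltr_pdivrMr// => /ltW; rewrite mulrC [n%:R * e]mulrC.
Qed.

(** * Separation by a function of the algebra *)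

Definition separated (B A : set X) : Prop :=
  exists u, [/\ in_real u, forall x, B x -> u x = 0 &
    forall x, ~ A x -> u x = 1].

Lemma separated_setT B : separated B setT.
Proof. by exists (fun=> 0); split=> // [|x []//]; exact: in_real_cst. Qed.

(** Passing from f to its squared modulus keeps the values 0 and 1, so that
    real functions are enough. *)
Lemma separated_complex A (B : set X) (f : X -> R[i]) : F f ->
  f @` B `<=` [set 0] -> f @` (~` A) `<=` [set 1] -> separated B A.
Proof.
move=> Ff fB fA.
exists (fun x => complex.Re (f x) ^+ 2 + complex.Im (f x) ^+ 2); split.
- have := cstarM F_alg Ff (cstarC F_alg Ff); rewrite /in_real.
  congr F; apply/funext => x /=; case: (f x) => a b.
  by simpc; congr Complex; ring.
- by move=> x Bx; rewrite (fB (f x)) /=; [ring|exists x].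
- by move=> x Ax; rewrite (fA (f x)) /=; [ring|exists x].
Qed.

Lemma separatedS (B B' A A' : set X) :
  B `<=` B' -> A' `<=` A -> separated B' A' -> separated B A.
Proof.
move=> BB' AA' [u [Fu uB uA]]; exists u; split=> // x.
  by move/BB'/uB.
by move=> nAx; apply: uA => /AA'.
Qed.

Lemma separatedC (B A : set X) : separated B A -> separated (~` A) (~` B).
Proof.
move=> [u [Fu uB uA]]; exists (fun x => 1 - u x); split.
- by apply: in_realB => //; exact: in_real_cst.
- by move=> x /uA ->; rewrite subrr.
- by move=> x /contrapT /uB ->; rewrite subr0.
Qed.

(** The function 1 - (1 - u) (1 - v) vanishes where both u and v do, and is 1
    as soon as one of them is. *)
Lemma separatedI (B B' A A' : set X) : separated B A -> separated B' A' ->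
  separated (B `&` B') (A `&` A').
Proof.
move=> [u [Fu uB uA]] [v [Fv vB vA]].
exists (fun x => 1 - (1 - u x) * (1 - v x)); split.
- apply: in_realB; first exact: in_real_cst.
  by apply: in_realM; apply: in_realB => //; exact: in_real_cst.
- by move=> x [/uB -> /vB ->]; ring.
- by move=> x /not_andP[/uA ->|/vA ->]; ring.
Qed.

(** The middle set is {u <= 1/2}.  On its complement min(2u, 1) is 1, and on it
    max(2u - 1, 0) is 0; both functions are combinations of u, constants and
    |2u - 1|. *)
Lemma separated_interpolate (B A : set X) : separated B A ->
  exists2 E, separated B E & separated E A.
Proof.
move=> [u [Fu uB uA]].
have F2u : in_real (fun x => 2 * u x).
  by apply: in_realM => //; exact: in_real_cst.
have Fabs : in_real (fun x => `|2 * u x - 1|).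
  by apply/in_real_norm/in_realB => //; exact: in_real_cst.
exists [set x | 2 * u x <= 1].
  exists (fun x => 2^-1 * (2 * u x + 1 - `|2 * u x - 1|)); split.
  - apply: in_realM; first exact: in_real_cst.
    by apply: in_realB => //; apply: in_realD => //; exact: in_real_cst.
  - by move=> x /uB ->; rewrite mulr0 sub0r normrN1; field.
  - move=> x /negP; rewrite -ltNge => ux.
    by rewrite gtr0_norm ?subr_gt0//; field.
exists (fun x => 2^-1 * (2 * u x - 1 + `|2 * u x - 1|)); split.
- apply: in_realM; first exact: in_real_cst.
  by apply: in_realD => //; apply: in_realB => //; exact: in_real_cst.
- by move=> x /= ux; rewrite ler0_norm ?subr_le0//; field.
- by move=> x /uA ->; rewrite mulr1 ger0_norm; [field|lra].
Qed.

(** * Cores of filters and F-filters *)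

(** The largest F-filter contained in the filter [phi]. *)
Definition core (phi : set_system X) : set_system X :=
  [set A | exists2 B, phi B & separated B A].

(** The given notion asks for image sets exactly {0} and {1}, hence excludes
    A = X; the core allows empty images, and X is in the core of any
    filter. *)
Lemma is_FfilterP (phi : set_system X) :
  is_Ffilter F phi <-> ProperFilter phi /\ phi `<=` core phi.
Proof.
split=> [[pF [_ _ phiF]]|[pF phiF]]; split=> //.
  move=> A phiA; have [->|AT] := pselect (A = setT).
    by exists setT; [exact: filterT|exact: separated_setT].
  have [B [f [phiB Ff fB fA]]] := phiF _ phiA AT.
  by exists B => //; apply: (separated_complex Ff); rewrite ?fB ?fA.
split=> [|A /filter_ex//|A phiA AT]; first by exists setT; exact: filterT.
have [B phiB [u [Fu uB uA]]] := phiF _ phiA.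
have /filter_ex[b Bb] := phiB.
have [a nAa] : exists a, ~ A a.
  by apply/existsNP => allA; apply: AT; apply/seteqP; split.
exists B, (fun x => (u x)%:C); split=> //; apply/seteqP; split.
- by move=> _ [x /uB -> <-].
- by move=> _ ->; exists b => //; rewrite uB.
- by move=> _ [x /uA -> <-].
- by move=> _ ->; exists a => //; rewrite uA.
Qed.

Lemma core_sub (phi : set_system X) : Filter phi -> core phi `<=` phi.
Proof.
move=> phiF A [B phiB [u [_ uB uA]]]; apply: filterS phiB => x /uB ux0.
by apply: contrapT => /uA; rewrite ux0 => /esym/eqP; rewrite oner_eq0.
Qed.

Lemma core_mono (phi psi : set_system X) :
  phi `<=` psi -> core phi `<=` core psi.
Proof. by move=> sub A [B /sub psiB BA]; exists B. Qed.

(** Interpolation is what makes the core contained in its own core: if B is in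
    [phi] and B << E << A, then E is itself in the core. *)
Lemma core_Ffilter (phi : set_system X) :
  ProperFilter phi -> is_Ffilter F (core phi).
Proof.
move=> phiF; apply/is_FfilterP; split; first split.
- by move/core_sub/filter_not_empty.
- split=> [|A A' [B pB BA] [B' pB' BA']|A A' AA' [B pB BA]].
  + by exists setT; [exact: filterT|exact: separated_setT].
  + by exists (B `&` B'); [exact: filterI|exact: separatedI].
  + by exists B => //; exact: separatedS BA.
- move=> A [B pB /separated_interpolate[E BE EA]].
  by exists E => //; exists B.
Qed.

(** For an F-filter, not containing A means that the complement of A can be
    adjoined without producing the empty set; the core of the enlarged filter
    still contains [phi], since [phi] is its own core. *)
Lemma Ffilter_adjoin (phi : set_system X) (A : set X) :
  is_Ffilter F phi -> ~ phi A ->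
  exists psi, [/\ is_Ffilter F psi, phi `<=` psi &
    forall B, separated B A -> psi (~` B)].
Proof.
move=> /is_FfilterP[phiF phi_core] nphiA.
have witF : ProperFilter (within (~` A) phi).
  split; last exact: within_filter.
  move=> AF; apply: nphiA.
  have {}AF : phi [set x | (~` A) x -> set0 x] by exact: AF.
  by apply: filterS AF => x; exact: contrapT.
exists (core (within (~` A) phi)); split; first exact: core_Ffilter.
  apply: subset_trans phi_core _; apply: core_mono => D phiD.
  by apply: filterS phiD => x.
move=> B /separatedC BA; exists (~` A) => //.
exact: (@withinT X phi).
Qed.

(** An F-ultrafilter need not contain A or its complement, but it decides
    between A and the complement of any B << A: by maximality it equals the
    F-filter obtained by adjoining the complement of A. *)
Lemma Fultrafilter_dichotomy (p : set_system X) (B A : set X) :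
  is_Fultrafilter F p -> separated B A -> ~ p A -> p (~` B).
Proof.
move=> [pF pmax] BA npA.
have [psi [psiF p_psi psiB]] := Ffilter_adjoin pF npA.
by rewrite -(pmax _ psiF p_psi); exact: psiB.
Qed.

(** * F-ultrafilters above an F-filter *)

(** Zorn's lemma: a union of a non-empty chain of F-filters is an F-filter. *)
Lemma Fultrafilter_extension (phi : set_system X) :
  is_Ffilter F phi -> exists2 p, is_Fultrafilter F p & phi `<=` p.
Proof.
move=> phiF.
pose T := {psi : set_system X | is_Ffilter F psi /\ phi `<=` psi}.
pose t0 : T := exist _ phi (conj phiF (@subset_refl _ phi)).
pose le (s t : T) := `[< sval s `<=` sval t >].
have [|t s u /asboolP st /asboolP tu|C Ctot|[p [pF phi_p]] pmax] :=
  @ZL_preorder T t0 le.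
- by move=> s; exact/asboolP.
- exact/asboolP/(subset_trans st).
- have [[s0 Cs0]|C0] := pselect (C !=set0); last first.
    by exists t0 => s Cs; case: C0; exists s.
  pose U := \bigcup_(s in C) sval s.
  have phiU : phi `<=` U.
    by move=> A phiA; exists s0 => //; case: (svalP s0) => _; exact.
  suff UF : is_Ffilter F U.
    exists (exist _ U (conj UF phiU)) => s Cs.
    by apply/asboolP => A sA; exists s.
  apply/is_FfilterP; split; first split.
  + by case=> -[s [sF ?]] /= _; case: sF => ? _; exact: filter_not_empty.
  + split=> [|A B [s Cs sA] [t Ct tB]|A B AB [s Cs sA]].
    * exists s0 => //; case: (svalP s0) => -[? _] _; exact: filterT.
    * have [/asboolP st|/asboolP ts] := Ctot _ _ Cs Ct.
        exists t => //; case: (svalP t) => -[? _] _.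
        by apply: filterI => //; exact: st.
      exists s => //; case: (svalP s) => -[? _] _.
      by apply: filterI => //; exact: ts.
    * by exists s => //; case: (svalP s) => -[? _] _; exact: filterS AB sA.
  + move=> A [s Cs sA]; case: (svalP s) => /is_FfilterP[_ s_core] _.
    by have [B sB BA] := s_core _ sA; exists B => //; exists s.
- exists p => //; split=> // q qF pq.
  apply/seteqP; split=> //.
  have phi_q := subset_trans phi_p pq.
  have /asboolP := pmax (exist _ q (conj qF phi_q)) (asboolT pq).
  exact.
Qed.

(** If A is not in [phi], an F-ultrafilter above the F-filter obtained by
    adjoining the complement of A cannot contain A: it would contain some
    B << A, whose complement it also contains. *)
Lemma Ffilter_inter_hat (phi : set_system X) (A : set X) : is_Ffilter F phi ->
  phi A <-> (forall p, hat_filter F phi p -> sval p A).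
Proof.
move=> phiF; split=> [phiA p|allA]; first exact.
apply: contrapT => nphiA.
have [psi [psiF phi_psi psiC]] := Ffilter_adjoin phiF nphiA.
have [p pU psi_p] := Fultrafilter_extension psiF.
have pA : p A.
  exact: (allA (exist _ p pU) (subset_trans phi_psi psi_p)).
have [/is_FfilterP[pF p_core] _] := pU.
have [B pB /psiC/psi_p pCB] := p_core _ pA.
have : p (B `&` ~` B) by exact: filterI.
by rewrite setICr => /filter_not_empty.
Qed.

(** * The F-filter of a closed set *)

(** The core turns the intersection of the members of C into an F-filter.
    This does not enlarge the hat beyond C: closedness provides, for q outside
    C, a set A in q lying in no member of C, and since q is its own core there
    are B' << B << A in q, which leaves room to push the complement of B' into
    the core. *)
Lemma hat_filter_core_bigcap (C : set (delta F)) : C !=set0 -> closed C ->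
  let phi := [set A | forall p, C p -> sval p A] in
  is_Ffilter F (core phi) /\ hat_filter F (core phi) = C.
Proof.
move=> [p0 Cp0] Ccl phi.
have pF (p : delta F) : ProperFilter (sval p) by case: (svalP p) => -[].
have phiF : ProperFilter phi.
  split; first by move/(_ _ Cp0); exact: filter_not_empty.
  split=> [p _|A B phiA phiB p Cp|A B AB phiA p Cp].
  - exact: filterT.
  - by apply: filterI; [exact: phiA|exact: phiB].
  - exact: filterS AB (phiA _ Cp).
split; first exact: core_Ffilter.
apply/seteqP; split=> [q core_q|p Cp A /core_sub]; last exact.
apply: contrapT => nCq.
have [D _ D_eq] : open (~` C) by exact: closed_openC.
have [A DA qA] : (\bigcup_(A in D) hat F A) q by rewrite D_eq.
have nCA p : C p -> ~ sval p A.
  move=> Cp pA; suff : (~` C) p by [].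
  by rewrite -D_eq; exists A.
have [/is_FfilterP[_ q_coreq] _] := svalP q.
have [B qB BA] := q_coreq _ qA.
have [B' qB' B'B] := q_coreq _ qB.
have phiCB : phi (~` B).
  by move=> p Cp; exact: (Fultrafilter_dichotomy (svalP p) BA (nCA p Cp)).
have qCB' : sval q (~` B').
  by apply: core_q; exists (~` B) => //; exact: separatedC.
have : sval q (B' `&` ~` B') by exact: filterI.
by rewrite setICr => /filter_not_empty.
Qed.

End FFilterTheory.

Theorem theorem21 (R : realType) (X : Type) (F : set (X -> R[i]))
    (C : set (delta F)) :
  inhabited X ->
  cstar_subalgebra F ->
  (forall c : R[i], F (cst c)) ->
  C !=set0 ->
  closed C ->
  exists! phi : set_system X, is_Ffilter F phi /\ hat_filter F phi = C.
Proof.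
move=> X_inh F_alg F_cst C_neq0 C_closed.
have [coreF hat_core] :=
  hat_filter_core_bigcap X_inh F_alg F_cst C_neq0 C_closed.
eexists; split; first by split; [exact: coreF|exact: hat_core].
move=> psi [psiF hat_psi]; apply/funext => A; apply/propext.
rewrite (Ffilter_inter_hat X_inh F_alg F_cst _ coreF).
by rewrite (Ffilter_inter_hat X_inh F_alg F_cst _ psiF) hat_psi hat_core.
Qed.
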